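(* Let $G$ be a $d$-dimensional simplicial complex and let $(F,R)$ be a rooted forest of $G$. The number of fitting orientations of $(F,R)$ is greater than or equal to $|H_{d-1}(F,R)|$. In particular, any rooted forest admits a fitting orientation.
   Context: A simplicial complex on $n$ vertices is a nonempty collection $G$ of subsets of $[n]=\{1,\dots,n\}$ closed under taking subsets; its elements are called faces. A $k$-face is a face of cardinality $k+1$ (so $\emptyset$ is the $(-1)$-face), $G_k$ is the set of $k$-faces, and the dimension $d\ge 0$ of $G$ is the maximal dimension of its faces. Incidence matrix: for $k\ge 0$, $\partial_k^{G}$ is the matrix with rows indexed by $G_{k-1}$ and columns indexed by $G_k$ whose entry $\partial_k^{G}[r,f]$ is $(-1)^j$ if $f=\{v_0,\dots,v_k\}$ with $v_0<\cdots<v_k$ and $r=f\setminus\{v_j\}$, and $0$ if $r\not\subset f$. It is also viewed as the boundary map sending combinations of $k$-faces to combinations of $(k-1)$-faces. A subset $F\subseteq G_d$ is a forest of $G$ if the columns of $\partial_d^{G}$ indexed by $F$ are linearly independent (over $\mathbb{R}$). For $R\subseteq G_{d-1}$ write $\overline{R}=G_{d-1}\setminus R$. For a forest $F$, let $\partial_d^{F}$ be the submatrix of $\partial_d^{G}$ with columns indexed by $F$ and all rows indexed by $G_{d-1}$; $R$ is a root of $F$ if the rows of $\partial_d^{F}$ indexed by $\overline{R}$ form a basis of the row space of $\partial_d^{F}$. A rooted forest of $G$ is a pair $(F,R)$ where $F\subseteq G_d$ is a forest of $G$ (possibly empty) and $R\subseteq G_{d-1}$ is a root of $F$. Relative homology: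 for $F\subseteq G_d$ and $R\subseteq G_{d-1}$, let $\Psi_{F,R}:\mathbb{Z}F\to \mathbb{Z}G_{d-1}/\mathbb{Z}R$ be the group homomorphism $x\mapsto \partial_d^{G}(x)+\mathbb{Z}R$, where $\mathbb{Z}S$ denotes the free abelian group on a set $S$. Then $H_{d-1}(F,R)=\operatorname{coker}\Psi_{F,R}=(\mathbb{Z}G_{d-1}/\mathbb{Z}R)/\operatorname{Im}(\Psi_{F,R})$, and $|H_{d-1}(F,R)|$ is its cardinality. A fitting orientation of a rooted forest $(F,R)$ is a bijection $\phi:\overline{R}\to F$ such that $r\subset\phi(r)$ for every $r\in\overline{R}$. *)

(* Defs.v *)
From HB Require Import structures.
From mathcomp Require Import all_boot all_order all_algebra.
From mathcomp Require Import boolp reals.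

(* The vertices 1, ..., n are the elements of 'I_n. *)

Set Implicit Arguments.
Unset Strict Implicit.
Unset Printing Implicit Defensive.

Import Order.TTheory GRing.Theory Num.Theory.
Local Open Scope ring_scope.
Local Open Scope quotient_scope.

Definition simplicial_complex n (G : {set {set 'I_n}}) : Prop :=
  G != set0 /\ forall f g : {set 'I_n}, f \in G -> g \subset f -> g \in G.

(* Indexed by cardinality, so that dimension -1 needs no special treatment:
   [faces G k.+1] is the set of k-faces and [faces G 0] that of (-1)-faces.
   For G of dimension d, G_d is [faces G d.+1] and G_{d-1} is [faces G d]. *)
Definition faces n (G : {set {set 'I_n}}) (c : nat) : {set {set 'I_n}} :=
  [set f in G | #|f| == c].

Definition has_dim n (G : {set {set 'I_n}}) (d : nat) : Prop :=
  (\max_(f in G) #|f| = d.+1)%N.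

(* [#|[set u in f | (u < v)%N]|] is the index j of v = v_j in the increasing
   enumeration v_0 < v_1 < ... of f. *)
Definition incidence n (r f : {set 'I_n}) : int :=
  if [pick v in f | r == f :\ v] is Some v
  then (-1) ^+ #|[set u in f | (u < v)%N]| else 0.

(* For S = G_{k-1} and T = G_k this is the incidence matrix of dimension k;
   for smaller S and T it is the submatrix with rows in S and columns in T. *)
Definition incidence_mx n (S T : {set {set 'I_n}}) : 'M[int]_(#|S|, #|T|) :=
  \matrix_(i, j) incidence (enum_val i) (enum_val j).

Definition real_incidence_mx (K : realType) n (S T : {set {set 'I_n}}) :
  'M[K]_(#|S|, #|T|) := map_mx intr (incidence_mx S T).

Definition forest (K : realType) n (G : {set {set 'I_n}}) (d : nat)
    (F : {set {set 'I_n}}) : Prop :=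
  F \subset faces G d.+1 /\
  row_free (real_incidence_mx K (faces G d) F)^T.

Definition compl_root n (G : {set {set 'I_n}}) (d : nat)
  (R : {set {set 'I_n}}) : {set {set 'I_n}} := faces G d :\: R.

Definition root_of (K : realType) n (G : {set {set 'I_n}}) (d : nat)
    (F R : {set {set 'I_n}}) : Prop :=
  [/\ R \subset faces G d,
      row_free (real_incidence_mx K (compl_root G d R) F)
    & (real_incidence_mx K (compl_root G d R) F
         == real_incidence_mx K (faces G d) F)%MS].

Definition rooted_forest (K : realType) n (G : {set {set 'I_n}}) (d : nat)
    (F R : {set {set 'I_n}}) : Prop :=
  forest K G d F /\ root_of K G d F R.

(* The free abelian group on S. *)
Definition chains n (S : {set {set 'I_n}}) : zmodType := 'cV[int]_#|S|.

(* The subgroup of the chains on S supported on R, i.e. the image of the free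
   abelian group on R when R is a subset of S. *)
Definition supported n (S R : {set {set 'I_n}}) : {pred chains S} :=
  fun c : 'cV[int]_#|S| => [forall i, (enum_val i \notin R) ==> (c i 0 == 0)].
Arguments supported {n} S R.

Fact supported_zmod_closed n (S R : {set {set 'I_n}}) :
  zmod_closed (supported S R).
Proof.
split=> [|x y /forallP xR /forallP yR]; apply/forallP=> i; apply/implyP=> iR.
  by rewrite mxE.
by move: (xR i) (yR i); rewrite iR !mxE /= => /eqP-> /eqP->; rewrite subrr.
Qed.

HB.instance Definition _ n (S R : {set {set 'I_n}}) :=
  GRing.isZmodClosed.Build (chains S) (supported S R)
    (@supported_zmod_closed n S R).

Definition relative_chains n (S R : {set {set 'I_n}}) : zmodType :=
  Quotient.quot (supported S R : zmodClosed (chains S)).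

Definition relative_boundary n (G : {set {set 'I_n}}) (d : nat)
    (F R : {set {set 'I_n}}) (x : chains F) : relative_chains (faces G d) R :=
  \pi_(relative_chains (faces G d) R) (incidence_mx (faces G d) F *m x).
Arguments relative_boundary {n} G d {F} R x.

Fact relative_boundary_is_zmod_morphism n (G : {set {set 'I_n}}) (d : nat)
  (F R : {set {set 'I_n}}) : zmod_morphism (relative_boundary G d (F := F) R).
Proof.
by move=> x y; rewrite /relative_boundary -[RHS]raddfB /= -mulmxBr.
Qed.

HB.instance Definition _ n (G : {set {set 'I_n}}) (d : nat)
    (F R : {set {set 'I_n}}) :=
  GRing.isZmodMorphism.Build (chains F) (relative_chains (faces G d) R)
    (relative_boundary G d (F := F) R)
    (@relative_boundary_is_zmod_morphism n G d F R).

Definition relative_boundaries n (G : {set {set 'I_n}}) (d : nat)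
    (F R : {set {set 'I_n}}) : {pred relative_chains (faces G d) R} :=
  fun z => `[< exists x : chains F, relative_boundary G d R x = z >].
Arguments relative_boundaries {n} G d F R.

Fact relative_boundaries_zmod_closed n (G : {set {set 'I_n}}) (d : nat)
  (F R : {set {set 'I_n}}) : zmod_closed (relative_boundaries G d F R).
Proof.
split=> [|_ _ /asboolP[x <-] /asboolP[y <-]]; apply/asboolP.
  by exists 0; rewrite raddf0.
by exists (x - y); rewrite raddfB.
Qed.

HB.instance Definition _ n (G : {set {set 'I_n}}) (d : nat)
    (F R : {set {set 'I_n}}) :=
  GRing.isZmodClosed.Build (relative_chains (faces G d) R)
    (relative_boundaries G d F R) (@relative_boundaries_zmod_closed n G d F R).

(* H_{d-1}(F, R), as the cokernel of [relative_boundary G d R : ZF -> ZG_{d-1}/ZR]. *)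
Definition relative_homology n (G : {set {set 'I_n}}) (d : nat)
    (F R : {set {set 'I_n}}) : zmodType :=
  Quotient.quot
    (relative_boundaries G d F R : zmodClosed (relative_chains (faces G d) R)).

Definition fitting_orientation n (G : {set {set 'I_n}}) (d : nat)
    (F R : {set {set 'I_n}})
    (phi : {ffun {r | r \in compl_root G d R} -> {f | f \in F}}) : Prop :=
  bijective phi /\
  forall r : {r | r \in compl_root G d R}, val r \subset val (phi r).

Definition fitting_orientations n (G : {set {set 'I_n}}) (d : nat)
    (F R : {set {set 'I_n}}) :
    {set {ffun {r | r \in compl_root G d R} -> {f | f \in F}}} :=
  [set phi | `[< fitting_orientation phi >]].

(* Main.v *)
(** The root condition makes the incidence matrix with rows [compl_root G d R]
    and columns F square and nonsingular, and H_{d-1}(F, R) is its integral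
    cokernel, of order |det| by the Smith normal form.  All entries being in
    {-1, 0, 1}, every term of the Leibniz expansion of the determinant has
    absolute value at most 1, and the nonzero terms are the fitting
    orientations. *)
Require Import Defs.
From mathcomp Require Import all_boot all_order all_algebra perm.
From mathcomp Require Import boolp classical_sets functions cardinality reals.

Set Implicit Arguments.
Unset Strict Implicit.
Unset Printing Implicit Defensive.

Import Order.TTheory GRing.Theory Num.Theory.
Local Open Scope ring_scope.
Local Open Scope quotient_scope.

(** Bounds the order of the cokernel by [|\det A|] without forming the quotient: [f] separates
    cosets of the image of [A]. With Smith form [L *m D *m R], it records the residues of
    [invmx L *m x] modulo the diagonal of [D]. *)
Lemma coker_mx_embed n (A : 'M[int]_n) : \det A != 0 ->
  exists f : 'cV[int]_n -> 'I_`|\det A|%N,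
    forall x y, f x = f y -> exists u, x - y = A *m u.
Proof.
have [L uL [R uR [d _ ->]]] := int_Smith_normal_form A.
set D := \matrix_(i, j) _; have eqD : D = diag_mx (\row_(i < n) d`_i).
  by apply/matrixP => i j; rewrite !mxE.
have absz_unit (M : 'M[int]_n) : M \in unitmx -> `|\det M|%N = 1%N.
  by rewrite unitmxE => /orP[] /eqP->.
rewrite !det_mulmx !abszM (absz_unit L uL) (absz_unit R uR) mul1n muln1.
rewrite !mulf_eq0 !negb_or => /andP[/andP[_ D0] _].
pose T := {dffun forall i : 'I_n, 'I_`|(d`_i)%R|%N}.
have d0 (i : 'I_n) : d`_i != 0.
  move: D0; rewrite eqD det_diag => /prodf_neq0/(_ i isT).
  by rewrite mxE.
have modlt (z : int) (i : 'I_n) : (`|(z %% d`_i)%Z| < `|(d`_i)%R|)%N.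
  by rewrite -ltz_nat !abszE ger0_norm ?modz_ge0 ?ltz_mod.
have cardT : #|T| = `|\det D|%N.
  rewrite card_dep_ffun foldrE big_image /= eqD det_diag (big_morph absz abszM absz1).
  by apply: eq_bigr => i _; rewrite card_ord mxE.
rewrite -cardT.
pose g (x : 'cV[int]_n) : T := [ffun i => Ordinal (modlt ((invmx L *m x) i 0) i)].
exists (enum_rank \o g) => x y /= /enum_rank_inj gxy.
pose z := invmx L *m (x - y).
have dz i : (d`_i %| z i 0%R)%Z.
  have := congr1 (fun h : T => nat_of_ord (h i)) gxy.
  rewrite !ffunE /= => /(congr1 Posz); rewrite !abszE !ger0_norm ?modz_ge0 //.
  by move/eqP; rewrite eqz_mod_dvd /z mulmxBr !mxE.
exists (invmx R *m \col_i (z i ord0 %/ d`_i)%Z).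
rewrite -!mulmxA (mulKVmx uR).
suff -> : D *m \col_i (z i ord0 %/ d`_i)%Z = z by rewrite mulKVmx.
apply/matrixP => i j; rewrite eqD mul_diag_mx mxE [X in X * _]mxE [X in _ * X]mxE.
by rewrite mulrC (divzK (dz i)) (ord1 j).
Qed.

Lemma absz_det_le n (A : 'M[int]_n) : (forall i j, `|A i j| <= 1) ->
  (`|\det A| <= #|[set s : 'S_n | [forall i, A i (s i) != 0]]|)%N.
Proof.
move=> A1; rewrite -lez_nat abszE /determinant.
apply: (le_trans (ler_norm_sum _ _ _)).
rewrite -sum1_card -natz natr_sum [leRHS]big_mkcond /=.
apply: ler_sum => s _; rewrite normrM normr_sign mul1r normr_prod inE.
case: ifPn => [_|/forallPn[i /negPn/eqP As0]].
  by apply: prodr_ile1 => i _; rewrite normr_ge0 A1.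
by rewrite (bigD1 i) //= As0 normr0 mul0r.
Qed.

(** Functions rather than permutations, because the row and column counts [#|compl_root G d R|] and
    [#|F|] are only provably equal. *)
Definition nz_matchings m n (A : 'M[int]_(m, n)) : {set {ffun 'I_m -> 'I_n}} :=
  [set p : {ffun 'I_m -> 'I_n} | injectiveb p && [forall i, A i (p i) != 0]].

Lemma coker_embed_matchings (K : realType) m n (A : 'M[int]_(m, n)) :
  m = n -> (forall i j, `|A i j| <= 1) ->
  row_free (map_mx intr A : 'M[K]_(m, n)) ->
  exists f : 'cV[int]_m -> 'I_#|nz_matchings A|,
    forall x y, f x = f y -> exists u, x - y = A *m u.
Proof.
move=> mn; subst n => A1 freeA.
have detA : \det A != 0.
  move: freeA; rewrite row_free_unit unitmxE det_map_mx unitfE.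
  by rewrite intr_eq0.
have [f fP] := coker_mx_embed detA.
have le_det : (`|\det A| <= #|nz_matchings A|)%N.
  apply: (leq_trans (absz_det_le A1)).
  (* A permutation is determined by its underlying function, which is injective. *)
  rewrite -(card_imset _ (val_inj : injective (@pval _))).
  apply/subset_leq_card/fintype.subsetP => p.
  case/imsetP => s; rewrite !inE => /forallP As ->; rewrite (valP s) /=.
  by apply/forallP => i; rewrite pvalE.
exists (widen_ord le_det \o f) => x y /(congr1 val) /= fxy.
by apply: fP; apply: val_inj.
Qed.

Lemma incidence_norm_le1 n (r f : {set 'I_n}) : `|incidence r f| <= 1.
Proof.
rewrite /incidence; case: pickP => [v _|_]; last by rewrite normr0.
by rewrite normrX normrN1 expr1n.
Qed.

Lemma incidence_neq0_sub n (r f : {set 'I_n}) : incidence r f != 0 -> r \subset f.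
Proof.
rewrite /incidence; case: pickP => [v /andP[_ /eqP->] _|]; first exact: subD1set.
by rewrite eqxx.
Qed.

(** Both sides are the rank of the incidence matrix of [F]: independent columns give [#|F|], a row
    basis gives the left side. *)
Lemma rooted_forest_card (K : realType) n (G F R : {set {set 'I_n}}) d :
  rooted_forest K G d F R -> #|compl_root G d R| = #|F|.
Proof.
case=> [[_ freeF]] [_ freeR /eqmxP eqR].
by rewrite -(eqP freeR) eqR -mxrank_tr; apply/eqP.
Qed.

Lemma matchings_le_fitting n (G F R : {set {set 'I_n}}) d :
  #|compl_root G d R| = #|F| ->
  (#|nz_matchings (incidence_mx (compl_root G d R) F)|
     <= #|fitting_orientations G d F R|)%N.
Proof.
move=> cardRF; set C := compl_root G d R.
pose idx (r : {r | r \in C}) : 'I_#|C| := enum_rank_in (valP r) (val r).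
have idxK r : enum_val (idx r) = val r by rewrite enum_rankK_in ?(valP r).
have idx_enum (i : 'I_#|C|) : idx (exist _ (enum_val i) (enum_valP i)) = i.
  by apply: enum_val_inj; rewrite idxK.
pose orient (p : {ffun 'I_#|C| -> 'I_#|F|}) :
    {ffun {r | r \in C} -> {f | f \in F}} :=
  [ffun r => exist _ (enum_val (p (idx r))) (enum_valP (p (idx r)))].
have orient_inj : injective orient.
  move=> p q /ffunP epq; apply/ffunP => i; apply: enum_val_inj.
  have := congr1 val (epq (exist _ (enum_val i) (enum_valP i))).
  by rewrite !ffunE /= idx_enum.
rewrite -(card_imset _ orient_inj); apply/subset_leq_card/fintype.subsetP => phi.
case/imsetP => p; rewrite inE => /andP[/injectiveP p_inj /forallP nz] ->.
rewrite inE; apply/asboolP; split.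
  (* Equal cardinalities turn the injectivity of the matching into bijectivity. *)
  apply: inj_card_bij => [r r'|]; last by rewrite !card_sig -cardRF.
  rewrite !ffunE => /(congr1 val) /= /enum_val_inj /p_inj /(congr1 enum_val).
  by rewrite !idxK => /val_inj.
move=> r; rewrite ffunE /=; apply: incidence_neq0_sub.
by have := nz (idx r); rewrite mxE idxK.
Qed.

(** Homology is a quotient of a quotient, so a chain is reached by two uses of [repr]: the outer
    quotient absorbs the boundary of [x], the inner one the chains supported on [R]. *)
Lemma relative_homology_reprP n (G : {set {set 'I_n}}) d (F R : {set {set 'I_n}})
    (z z' : relative_homology G d F R) (x : chains F) :
  let c (z : relative_homology G d F R) : chains (faces G d) := repr (repr z) in
  c z - c z' - incidence_mx (faces G d) F *m x \in supported (faces G d) R ->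
  z = z'.
Proof.
move=> c cP; rewrite -[z]reprK -[z']reprK; apply/eqP.
rewrite -Quotient.idealrBE; apply/asboolP; exists x.
rewrite -[repr z]reprK -[repr z']reprK -raddfB.
by apply/esym/eqP; rewrite -Quotient.idealrBE.
Qed.

Theorem proposition28 (K : realType) (n d : nat)
    (G F R : {set {set 'I_n}})
    (hG : simplicial_complex G) (hd : has_dim G d)
    (hFR : rooted_forest K G d F R) :
  ([set: relative_homology G d F R]%classic
     #<= `I_(#|fitting_orientations G d F R|)%classic)%card
  /\ exists phi : {ffun {r | r \in compl_root G d R} -> {f | f \in F}},
       fitting_orientation phi.
Proof.
have cardRF := rooted_forest_card hFR.
set C := compl_root G d R in cardRF *.
have freeC : row_free (real_incidence_mx K C F) by case: hFR => _ [].
have [|f fP] := coker_embed_matchings cardRF _ freeC.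
  by move=> i j; rewrite mxE incidence_norm_le1.
have le_fit := matchings_le_fitting cardRF.
split.
  have memC (i : 'I_#|C|) : enum_val i \in faces G d.
    by have := enum_valP i; rewrite inE => /andP[].
  pose rk (i : 'I_#|C|) : 'I_#|faces G d| := enum_rank_in (memC i) (enum_val i).
  have rkK i : enum_val (rk i) = enum_val i by rewrite enum_rankK_in.
  pose rep (z : relative_homology G d F R) : 'cV[int]__ := repr (repr z).
  (* A class is sent to the value of [f] on its representative restricted to the faces outside
     [R]. *)
  apply/pcard_leP/injfunPex; exists (fun z => f (rowsub rk (rep z)) : nat).
    by move=> z _ /=; apply: leq_trans (ltn_ord _) le_fit.
  move=> z z' _ _ /= /val_inj/fP[u /colP eq_u].
  (* Coordinates in [R] are free; on the others, [eq_u] gives equality row by row. *)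
  apply: (@relative_homology_reprP _ _ _ _ _ _ _ u); apply/forallP => i.
  apply/implyP => iR.
  have iC : enum_val i \in C by rewrite inE iR enum_valP.
  pose k := enum_rank_in iC (enum_val i).
  have kK : enum_val k = enum_val i by rewrite enum_rankK_in.
  have rki : rk k = i by apply: enum_val_inj; rewrite rkK.
  have := eq_u k; rewrite !mxE rki => ->; rewrite subr_eq0; apply/eqP.
  by apply: eq_bigr => j _; rewrite !mxE kK.
(* The value [f 0] shows that the bounding ordinal type is inhabited. *)
have : (0 < #|fitting_orientations G d F R|)%N.
  exact: leq_trans (leq_ltn_trans (leq0n _) (ltn_ord (f 0))) le_fit.
by case/card_gt0P => phi; rewrite inE => /asboolP fit; exists phi.
Qed.
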